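(* Let $m,n,r\ge0$ and $k\ge0$ be integers and $\alpha,\beta,x$ indeterminates. Then $$S(m+n,k;\alpha,\beta,r)=\sum_{i=0}^n \sum_{j=0}^m \binom{n}{i}S(m,j;\alpha,\beta,r)\,S(i,k-j;\alpha,\beta,r)\prod_{\ell=0}^{n-i-1}((m+\ell)\alpha+j\beta)$$ and $$B_{m+n;\alpha,\beta,r}(x)=\sum_{i=0}^n \sum_{j=0}^m \binom{n}{i}x^jS(m,j;\alpha,\beta,r)\,B_{i;\alpha,\beta,r}(x)\prod_{\ell=0}^{n-i-1}((m+\ell)\alpha+j\beta).$$
   Context: For $\theta$ and $k\ge1$ let $(x)^{(k,\theta)}=x(x-\theta)\cdots(x-k\theta+\theta)$, and $(x)^{(0,\theta)}=1$. The generalized Stirling numbers $S(n,k;\alpha,\beta,r)$ are the coefficients defined by the polynomial identity $(x)^{(n,-\alpha)}=\sum_{k=0}^n S(n,k;\alpha,\beta,r)(x-r)^{(k,\beta)}$, with $S(n,k;\alpha,\beta,r)=0$ for $k<0$ or $k>n$. The generalized Bell polynomial is $B_{n;\alpha,\beta,r}(x)=\sum_{k=0}^n S(n,k;\alpha,\beta,r)x^k$. Empty products equal $1$. *)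

(* Defs.v *)
From HB Require Import structures.
From mathcomp Require Import all_boot all_order all_algebra.

Set Implicit Arguments.
Unset Strict Implicit.
Unset Printing Implicit Defensive.

Import GRing.Theory.
Local Open Scope ring_scope.

(* (x)^{(k, theta)} = x (x - theta) ... (x - k theta + theta) *)
Definition gfact (A : pzRingType) (x theta : A) (k : nat) : A :=
  \prod_(i < k) (x - theta *+ i).

Section GeneralizedStirling.

(* alpha and beta range over an arbitrary commutative ring; the formal version,
   with alpha and beta indeterminates, is R = Z[alpha, beta]. *)
Variables (R : comNzRingType) (alpha beta : R) (r : nat).

Definition stirling_lhs (n : nat) : {poly R} := gfact 'X (- alpha)%:P n.

Definition stirling_basis (k : nat) : {poly R} :=
  gfact ('X - r%:R%:P) beta%:P k.

Definition stirling_coefs_spec (n : nat) (s : {ffun 'I_n.+1 -> R}) : bool :=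
  stirling_lhs n == \sum_(k < n.+1) s k *: stirling_basis k.

Lemma gfact_monic_size (c theta : R) n :
  (gfact ('X - c%:P) theta%:P n \is monic) /\
  size (gfact ('X - c%:P) theta%:P n) = n.+1.
Proof.
have -> : gfact ('X - c%:P) theta%:P n =
    \prod_(i <- [seq c + theta *+ i | i <- iota 0 n]) ('X - i%:P).
  rewrite big_map -[n in LHS]card_ord -(subn0 n) -/(index_iota 0 n) big_mkord.
  rewrite /gfact card_ord subn0; apply: eq_bigr => i _.
  by rewrite polyCD polyCMn opprD addrA.
by rewrite monic_prod_XsubC size_prod_XsubC size_map size_iota.
Qed.

Lemma stirling_basis_span n (p : {poly R}) : (size p <= n)%N ->
  exists s : nat -> R, p = \sum_(k < n) s k *: stirling_basis k.
Proof.
elim: n p => [|n IHn] p.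
  by rewrite leqn0 size_poly_eq0 => /eqP->; exists (fun=> 0); rewrite big_ord0.
move=> sz_p; have [/monicP mb sb] := gfact_monic_size r%:R beta n.
have [|s Es] := IHn (p - p`_n *: stirling_basis n).
  apply/leq_sizeP => j le_nj; rewrite coefB coefZ.
  have [<-|neq_nj] := eqVneq n j.
    by move: mb; rewrite lead_coefE sb /= /stirling_basis => ->; rewrite mulr1 subrr.
  have lt_nj : (n < j)%N by rewrite ltn_neqAle neq_nj.
  rewrite nth_default ?(leq_trans sz_p) // sub0r.
  by rewrite [(stirling_basis n)`_j]nth_default ?mulr0 ?oppr0 // [X in (X <= _)%N]sb.
exists (fun k => if k == n then p`_n else s k).
rewrite big_ord_recr /= eqxx -[LHS](subrK (p`_n *: stirling_basis n)) Es.
congr (_ + _); apply: eq_bigr => k _.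
by rewrite ltn_eqF.
Qed.

Lemma stirling_coefs_exist n : exists s, @stirling_coefs_spec n s.
Proof.
have [_ sz] := gfact_monic_size 0 (- alpha) n; rewrite polyC0 subr0 in sz.
have [|s Es] := @stirling_basis_span n.+1 (stirling_lhs n).
  by rewrite sz.
exists [ffun k : 'I_n.+1 => s k]; apply/eqP; rewrite [LHS]Es.
by apply: eq_bigr => k _; rewrite ffunE.
Qed.

(* By stirling_basis_free below these coefficients are unique, so the choice
   operator has a single candidate. *)
Definition stirling_coefs (n : nat) : {ffun 'I_n.+1 -> R} :=
  xchoose (stirling_coefs_exist n).

Definition genStirling (n : nat) (k : int) : R :=
  match k with
  | Posz k' => if insub k' is Some i then stirling_coefs n i else 0
  | Negz _ => 0
  end.

Definition genBell (n : nat) : {poly R} :=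
  \sum_(k < n.+1) genStirling n k *: 'X^k.

Lemma genStirlingP n :
  gfact 'X (- alpha)%:P n =
  \sum_(k < n.+1) genStirling n k *: gfact ('X - r%:R%:P) beta%:P k.
Proof.
rewrite [LHS](eqP (xchooseP (stirling_coefs_exist n))).
by apply: eq_bigr => k _; rewrite /= valK.
Qed.

Lemma stirling_basis_free n (s t : nat -> R) :
  \sum_(k < n) s k *: stirling_basis k = \sum_(k < n) t k *: stirling_basis k ->
  forall k, (k < n)%N -> s k = t k.
Proof.
elim: n => // n IHn; rewrite !big_ord_recr /= => Est.
have coef_lo (u : nat -> R) : (\sum_(k < n) u k *: stirling_basis k)`_n = 0.
  rewrite coef_sum big1 // => k _; rewrite coefZ nth_default ?mulr0 //.
  by have [_ ->] := gfact_monic_size r%:R beta k.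
have [/monicP mb sb] := gfact_monic_size r%:R beta n.
have Bn : (stirling_basis n)`_n = 1.
  by move: mb; rewrite lead_coefE sb.
have Esn : s n = t n.
  have := congr1 (fun p : {poly R} => p`_n) Est.
  by rewrite !coefD !coefZ !coef_lo Bn !mulr1 !add0r.
move=> k; rewrite ltnS leq_eqVlt => /predU1P[-> //|].
by apply: IHn; move: Est; rewrite Esn => /addIr.
Qed.

Lemma genStirling_unique n (s : nat -> R) :
  gfact 'X (- alpha)%:P n =
    \sum_(k < n.+1) s k *: gfact ('X - r%:R%:P) beta%:P k ->
  forall k : nat, (k <= n)%N -> genStirling n k = s k.
Proof.
rewrite genStirlingP => Es k le_kn.
exact: (stirling_basis_free (s := fun k => genStirling n k) Es).
Qed.

End GeneralizedStirling.

(* Main.v *)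
Require Import Defs.
From HB Require Import structures.
From mathcomp Require Import all_boot all_order all_algebra.
From mathcomp Require Import ring.
Import GRing.Theory.
Local Open Scope ring_scope.

(** Let [b_k = (x - r)^{(k, beta)}] and let [L] be the injective linear map
    sending [X^k] to [b_k], so that [L B_n = (x)^{(n, -alpha)}].  Splitting
    [(x)^{(m+n, -alpha)} = (x)^{(m, -alpha)} (x + m alpha)^{(n, -alpha)}],
    expand the first factor on the [b_j], and for each [j] apply Vandermonde's
    identity to [x + m alpha = (x - j beta) + (m alpha + j beta)].  Since
    [b_j(x) b_k(x - j beta) = b_{j+k}(x)], the term
    [b_j(x) (x - j beta)^{(i, -alpha)}] is [L (X^j B_i)].  This gives the
    identity for Bell polynomials, whose coefficients are the Stirling
    numbers. *)

Lemma gfactS (A : pzRingType) (x t : A) n :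
  gfact x t n.+1 = gfact x t n * (x - t *+ n).
Proof. by rewrite /gfact big_ord_recr. Qed.

Lemma gfact_add (A : pzRingType) (x t : A) m n :
  gfact x t (m + n) = gfact x t m * gfact (x - t *+ m) t n.
Proof.
elim: n => [|n IHn]; first by rewrite addn0 /gfact big_ord0 mulr1.
by rewrite addnS !gfactS IHn mulrA mulrnDr opprD addrA.
Qed.

Lemma gfact_Vandermonde (A : comPzRingType) (a b t : A) n :
  gfact (a + b) t n =
  \sum_(i < n.+1) (gfact a t i * gfact b t (n - i)) *+ 'C(n, i).
Proof.
elim: n => [|n IHn]; first by rewrite big_ord1 /gfact !big_ord0 mulr1.
rewrite gfactS IHn.
(* The new factor [a + b - t *+ n] splits as [(a - t *+ i) + (b - t *+ (n - i))], so each term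
   lengthens one of its two factorials; Pascal's rule then recombines the two sums. *)
transitivity (\sum_(i < n.+1) (gfact a t i.+1 * gfact b t (n - i)) *+ 'C(n, i)
            + \sum_(i < n.+1) (gfact a t i * gfact b t (n.+1 - i)) *+ 'C(n, i)).
  rewrite -big_split mulr_suml; apply: eq_bigr => -[i /=]; rewrite ltnS => le_in _.
  rewrite -mulrnDl subSn // !gfactS mulrnAl; congr (_ *+ _).
  by rewrite -[in t *+ n](subnKC le_in) mulrnDr; ring.
rewrite [RHS]big_ord_recl /= bin0 [X in _ + X]big_ord_recl /= bin0 addrCA.
congr (_ + _); under [RHS]eq_bigr do rewrite binS mulrnDr.
rewrite big_split /= addrC; congr (_ + _).
by rewrite [RHS]big_ord_recr /= bin_small // mulr0n addr0.
Qed.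

Section BellUmbral.

Variables (R : comNzRingType) (alpha beta : R) (r : nat).

Local Notation S := (genStirling alpha beta r).
Local Notation B := (genBell alpha beta r).
Local Notation b := (stirling_basis beta r).

Lemma genStirling_small n k : (n < k)%N -> S n k%:Z = 0.
Proof. by move=> lt_nk /=; rewrite insubF // ltnNge lt_nk. Qed.

Lemma coef_genBell n k : (B n)`_k = S n k%:Z.
Proof.
rewrite /genBell -(poly_def n.+1 (fun k => S n k%:Z)) coef_poly.
by case: ltnP => // lt_nk; rewrite genStirling_small.
Qed.

Lemma size_genBell n : (size (B n) <= n.+1)%N.
Proof. by apply/leq_sizeP => j lt_nj; rewrite coef_genBell genStirling_small. Qed.

(* Truncating at a fixed degree [N] keeps the map linear by construction. *)
Definition umbral N (p : {poly R}) : {poly R} := \sum_(k < N) p`_k *: b k.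

Fact umbral_is_linear N : linear (umbral N).
Proof.
move=> c p q; rewrite /umbral scaler_sumr -big_split; apply: eq_bigr => k _.
by rewrite coefD coefZ scalerDl scalerA.
Qed.

HB.instance Definition _ N :=
  GRing.isLinear.Build R {poly R} {poly R} *:%R (umbral N) (umbral_is_linear N).

Lemma umbralXn N k : (k < N)%N -> umbral N 'X^k = b k.
Proof.
move=> lt_kN; rewrite /umbral (bigD1 (Ordinal lt_kN)) //= coefXn eqxx scale1r.
rewrite big1 ?addr0 // => i ne_ik.
by rewrite coefXn -[_ == k]/(i == Ordinal lt_kN) (negPf ne_ik) scale0r.
Qed.

Lemma umbral_inj N (p q : {poly R}) : (size p <= N)%N -> (size q <= N)%N ->
  umbral N p = umbral N q -> p = q.
Proof.
move=> szp szq /stirling_basis_free Epq; apply/polyP => k.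
case: (ltnP k N) => [/Epq // | le_Nk].
by rewrite !nth_default ?(leq_trans _ le_Nk).
Qed.

Lemma stirling_basis_add j k : b (j + k) = b j * (b k \Po ('X - (beta *+ j)%:P)).
Proof.
rewrite /stirling_basis gfact_add; congr (_ * _).
rewrite /gfact rmorph_prod; apply: eq_bigr => i _ /=.
by rewrite -!polyCMn !comp_polyB !comp_polyC comp_polyX [X in X - _]addrAC.
Qed.

Lemma gfact_comp_poly (t : R) (q : {poly R}) n :
  gfact 'X t%:P n \Po q = gfact q t%:P n.
Proof.
rewrite /gfact rmorph_prod; apply: eq_bigr => i _ /=.
by rewrite -polyCMn comp_polyB comp_polyC comp_polyX.
Qed.

(** Expanding [B i], each ['X^(j + k)] goes to [b (j + k)], which is [b j] times a shift of [b k];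
    the shifted [b k] resum by [genStirlingP]. The bound on [j + i] keeps every monomial below the
    truncation. *)
Lemma umbral_XnMgenBell N j i : (j + i < N)%N ->
  umbral N ('X^j * B i) = b j * gfact ('X - (beta *+ j)%:P) (- alpha)%:P i.
Proof.
move=> lt_N; rewrite -gfact_comp_poly (genStirlingP _ beta r) /genBell.
rewrite mulr_sumr linear_sum [X in _ = _ * X]linear_sum mulr_sumr.
apply: eq_bigr => k _ /=.
rewrite -scalerAr linearZ /= -exprD umbralXn; last first.
  by apply: leq_ltn_trans lt_N; rewrite leq_add2l -ltnS.
by rewrite stirling_basis_add linearZ /= -scalerAr.
Qed.

Lemma gfact_polyC (c t : R) n : gfact c%:P t%:P n = (gfact c t n)%:P.
Proof.
rewrite /gfact rmorph_prod; apply: eq_bigr => i _.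
by rewrite /= polyCB polyCMn.
Qed.

Lemma gfact_rising m j n :
  gfact (alpha *+ m + beta *+ j) (- alpha) n =
  \prod_(0 <= l < n) ((m + l)%:R * alpha + j%:R * beta).
Proof.
rewrite /gfact big_mkord; apply: eq_bigr => l _.
by rewrite !mulr_natl mulrnDr mulNrn opprK addrAC.
Qed.

Lemma genBell_add m n : B (m + n) =
  \sum_(i < n.+1) \sum_(j < m.+1)
    (S m j%:Z * gfact (alpha *+ m + beta *+ j) (- alpha) (n - i) *+ 'C(n, i))
      *: ('X^j * B i).
Proof.
(* Both sides have degree at most [m + n], so truncating there loses nothing. *)
apply: (@umbral_inj (m + n).+1); first exact: size_genBell.
  apply: leq_trans (size_sum _ _ _) _; apply/bigmax_leqP => i _.
  apply: leq_trans (size_sum _ _ _) _; apply/bigmax_leqP => j _.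
  apply: leq_trans (size_scale_leq _ _) _.
  apply: leq_trans (size_polyMleq _ _) _; rewrite size_polyXn addSn /=.
  apply: leq_trans (leq_add (leqnn _) (size_genBell i)) _.
  by rewrite addnS ltnS leq_add // -ltnS.
(* This is [umbral_XnMgenBell] at [j = 0], where [b 0 = 1] and the shift is trivial. *)
have -> : umbral (m + n).+1 (B (m + n)) = gfact 'X (- alpha)%:P (m + n).
  have := @umbral_XnMgenBell (m + n).+1 0 (m + n) (ltnSn _).
  by rewrite expr0 mul1r /stirling_basis {1}/gfact big_ord0 mul1r mulr0n subr0.
rewrite gfact_add [X in X * _](genStirlingP _ beta r) mulr_suml.
rewrite linear_sum; under [RHS]eq_bigr do rewrite linear_sum.
rewrite exchange_big; apply: eq_bigr => j _.
set s := genStirling _ _ _ _ _.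
(* The second summand is constant, so its factorials are scalars that pass through [umbral]. *)
have -> : 'X - (- alpha)%:P *+ m =
    ('X - (beta *+ j)%:P) + (alpha *+ m + beta *+ j)%:P.
  by rewrite polyCD polyCN mulNrn opprK polyCMn; ring.
rewrite [X in _ * X = _]gfact_Vandermonde mulr_sumr; apply: eq_bigr => i _.
rewrite [RHS]linearZ /= umbral_XnMgenBell; last first.
  by rewrite ltnS leq_add // -ltnS.
rewrite gfact_polyC -!mul_polyC [in RHS]polyCMn polyCM /stirling_basis.
ring.
Qed.

End BellUmbral.

Theorem theorem3p8 (R : comNzRingType) (alpha beta : R) (m n r k : nat) :
  genStirling alpha beta r (m + n) k%:Z =
    \sum_(0 <= i < n.+1) \sum_(0 <= j < m.+1)
      'C(n, i)%:R * genStirling alpha beta r m j%:Z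
      * genStirling alpha beta r i (k%:Z - j%:Z)
      * \prod_(0 <= l < n - i) ((m + l)%:R * alpha + j%:R * beta)
  /\
  genBell alpha beta r (m + n) =
    \sum_(0 <= i < n.+1) \sum_(0 <= j < m.+1)
      'C(n, i)%:R * 'X^j * (genStirling alpha beta r m j%:Z)%:P
      * genBell alpha beta r i
      * \prod_(0 <= l < n - i) ((m + l)%:R * alpha + j%:R * beta)%:P.
Proof.
split.
  rewrite -coef_genBell genBell_add coef_sum big_mkord; apply: eq_bigr => i _.
  rewrite coef_sum big_mkord; apply: eq_bigr => j _.
  rewrite coefZ coefXnM coef_genBell -gfact_rising.
  (* For [k < j] both sides vanish: ['X^j] kills the coefficient on the left, and [genStirling] is 0
     at the negative index [k - j] on the right. *)
  case: ltnP => [lt_kj | le_jk]; last first.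
    by rewrite subzn //; ring.
  have -> : k%:Z - j%:Z = Negz (j - k).-1.
    by rewrite NegzE prednK ?subn_gt0 // -subzn 1?ltnW // opprB.
  by rewrite !mulr0 mul0r.
rewrite genBell_add big_mkord; apply: eq_bigr => i _.
rewrite big_mkord; apply: eq_bigr => j _.
by rewrite -rmorph_prod -gfact_rising -mul_polyC polyCMn polyCM; ring.
Qed.
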